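(* Let $S\subset T\subset\mathbb{R}^2$, with $|S|=2$ and $|T|=4$. The following statements are equivalent: a) $V_T(S)$ is nonempty and at most one-dimensional. b) The points of $T$ are the vertices of a cyclic quadrilateral, with the two points of $S$ located opposite to each other (i.e. they are the endpoints of a diagonal). c) $V_T(S)$ is a singleton.
   Context: For a finite nonempty set $T\subset\mathbb{R}^n$ and a nonempty proper subset $S\subset T$, the multipoint (higher order) Voronoi cell is $$V_T(S):=\left\{x\in\mathbb{R}^n : \max_{s\in S}\|x-s\|\le\min_{t\in T\setminus S}\|x-t\|\right\},$$ where $\|\cdot\|$ is the Euclidean norm. It is a convex set; its dimension is the dimension of its affine hull. A (convex) quadrilateral is cyclic if all four of its vertices lie on a single circle. *)

(* Defs.v *)
From HB Require Import structures.
From mathcomp Require Import all_boot all_order all_algebra finmap.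
From mathcomp Require Import all_classical all_reals ereal.

Set Implicit Arguments.
Unset Strict Implicit.
Unset Printing Implicit Defensive.

Import Order.TTheory GRing.Theory Num.Theory.
Local Open Scope classical_set_scope.
Local Open Scope ring_scope.

(* The norm that MathComp-Analysis puts on 'rV[R]_n is the sup norm, hence a
   separate Euclidean norm. *)
Definition enorm (R : realType) (n : nat) (x : 'rV[R]_n) : R :=
  Num.sqrt (\sum_(i < n) x 0 i ^+ 2).

(* The maximum and the minimum are taken in \bar R so that their neutral
   elements exist; they are finite when S and T `\` S are nonempty. *)
Definition voronoi_cell (R : realType) (n : nat) (T S : {fset 'rV[R]_n}) :
    set 'rV[R]_n :=
  [set x | (\big[maxe/-oo]_(s <- S) (enorm (x - s))%:E
            <= \big[mine/+oo]_(t <- (T `\` S)%fset) (enorm (x - t))%:E)%E].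

Definition affine_hull (R : realType) (n : nat) (A : set 'rV[R]_n) :
    set 'rV[R]_n :=
  [set x | exists (k : nat) (c : 'I_k -> R) (p : 'I_k -> 'rV[R]_n),
     [/\ forall i, A (p i), \sum_i c i = 1 & x = \sum_i c i *: p i]].

(* The affine hull of A is a translate of a linear subspace of dimension d.
   No d : nat satisfies this when A is empty. *)
Definition has_affine_dim (R : realType) (n : nat) (A : set 'rV[R]_n)
    (d : nat) : Prop :=
  exists (p : 'rV[R]_n) (W : {vspace 'rV[R]_n}),
    \dim W = d /\ affine_hull A = [set p + w | w in [set` W]].

(* Twice the signed area of the triangle p q r; its sign tells on which side
   of the line pq the point r lies. *)
Definition signed_area2 (R : realType) (p q r : 'rV[R]_2) : R :=
  (q 0 0 - p 0 0) * (r 0 1 - p 0 1) - (q 0 1 - p 0 1) * (r 0 0 - p 0 0).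

Definition same_strict_side (R : realType) (p q x y : 'rV[R]_2) : Prop :=
  0 < signed_area2 p q x * signed_area2 p q y.

(* a, b, c, d are the vertices listed in the order in which they occur along
   the boundary, so the sides are ab, bc, cd, da and the diagonals ac, bd.
   Strictness excludes degenerate quadrilaterals (coinciding vertices or three
   collinear ones). *)
Definition convex_quadrilateral (R : realType) (a b c d : 'rV[R]_2) : Prop :=
  [/\ same_strict_side a b c d, same_strict_side b c d a,
      same_strict_side c d a b & same_strict_side d a b c].

Definition circle (R : realType) (o : 'rV[R]_2) (r : R) : set 'rV[R]_2 :=
  [set x | enorm (x - o) = r].

Definition cyclic_quadrilateral (R : realType) (a b c d : 'rV[R]_2) : Prop :=
  convex_quadrilateral a b c d /\
  exists (o : 'rV[R]_2) (r : R),
    0 < r /\ [/\ circle o r a, circle o r b, circle o r c & circle o r d].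

(* Main.v *)
Require Import Defs.
From mathcomp Require Import all_boot all_order all_algebra finmap.
From mathcomp Require Import all_classical all_reals ereal.
From mathcomp Require Import ring lra.

(** Each condition |x - s| <= |x - t| is an affine inequality in x.  If x lies in
    the cell of {a, c} and no direction strictly relaxes all the inequalities
    that are tight at x, then the directions c - x, a - x, x - b, x - d and 0
    show that the four points are equidistant from x, and the directions
    orthogonal to ac and to bd show that each of these chords separates the
    end points of the other one, so that ac and bd are the diagonals of a convex
    cyclic quadrilateral.  Conversely, in a convex quadrilateral the crossing of
    the diagonals gives a positive combination of the vectors a - b, a - d,
    c - b, c - d that vanishes, which leaves only the circumcenter in the
    cell. *)

Set Implicit Arguments.
Unset Strict Implicit.
Unset Printing Implicit Defensive.

Import Order.TTheory GRing.Theory Num.Theory.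
Local Open Scope ring_scope.

Definition dot (R : realType) (n : nat) (u v : 'rV[R]_n) : R :=
  \sum_(i < n) u 0 i * v 0 i.

Definition gap (R : realType) (n : nat) (x s t : 'rV[R]_n) : R :=
  dot (x - t) (x - t) - dot (x - s) (x - s).

(** * Cells as intersections of half-spaces, and their affine dimension *)

Section Dimension.
Variables (R : realType) (n : nat).
Implicit Types (u v w x y s t : 'rV[R]_n) (S T : {fset 'rV[R]_n}).

Lemma dot_ge0 u : 0 <= dot u u.
Proof. by apply: sumr_ge0 => i _; rewrite -expr2 sqr_ge0. Qed.

Lemma dotDl u v w : dot (u + v) w = dot u w + dot v w.
Proof. by rewrite -big_split; apply: eq_bigr => i _; rewrite mxE mulrDl. Qed.

Lemma dotZl h u w : dot (h *: u) w = h * dot u w.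
Proof. by rewrite mulr_sumr; apply: eq_bigr => i _; rewrite mxE mulrA. Qed.

Lemma dotNN u : dot (- u) (- u) = dot u u.
Proof. by apply: eq_bigr => i _; rewrite mxE mulrNN. Qed.

Lemma enormE u : enorm u = Num.sqrt (dot u u).
Proof. by congr Num.sqrt; apply: eq_bigr => i _; rewrite expr2. Qed.

Lemma le_enorm x s t : (enorm (x - s) <= enorm (x - t)) = (0 <= gap x s t).
Proof. by rewrite !enormE ler_sqrt ?dot_ge0// subr_ge0. Qed.

(** The terms quadratic in [h] cancel between the two squared distances, so the formula is exact for
    every [h], not only to first order. *)
Lemma gap_line x v h s t :
  gap (x + h *: v) s t = gap x s t + h * (2 * dot v (s - t)).
Proof.
rewrite /gap /dot -!sumrB !mulr_sumr -big_split/=.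
by apply: eq_bigr => i _; rewrite !mxE; ring.
Qed.

Lemma voronoi_cellP T S x :
  voronoi_cell T S x <->
  (forall s t, s \in S -> t \in (T `\` S)%fset -> 0 <= gap x s t).
Proof.
split=> [H s t sS tS|H].
  rewrite -le_enorm -lee_fin.
  apply: (le_trans _ (le_trans H _)).
    exact: (le_bigmax_seq _ s xpredT).
  exact: (ge_bigmin_seq _ t xpredT).
rewrite /voronoi_cell/= big_seq; apply: bigmax_le => [|s sS].
  exact: leNye.
rewrite big_seq; apply: le_bigmin => [|t tS]; first exact: leey.
by rewrite lee_fin le_enorm H.
Qed.

Lemma small_perturbation (I : eqType) (r : seq I) (A B : I -> R) :
  exists2 e, 0 < e & forall i, i \in r -> 0 < A i -> 0 < A i + e * B i.
Proof.
(* Strengthened to every [h] in []0, e]], so that the induction may shrink [e] at each new index. *)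
suff [e e0 H] : exists2 e, 0 < e &
    forall h, 0 < h <= e -> forall i, i \in r -> 0 < A i -> 0 < A i + h * B i.
  by exists e => //; apply: H; rewrite e0 lexx.
elim: r => [|j r [e e0 IH]]; first by exists 1.
have [Aj|Aj] := ltP 0 (A j); last first.
  exists e => // h he i; rewrite inE => /predU1P[->|ir]; last exact: IH.
  by move=> /lt_le_trans/(_ Aj); rewrite ltxx.
have B1 : 0 < `|B j| + 1 by rewrite ltr_wpDl.
(* Adding 1 keeps the denominator positive when [B j] is zero and makes [h] times the absolute value
   of [B j] strictly smaller than [A j]. *)
exists (Num.min e (A j / (`|B j| + 1))) => [|h].
  by rewrite lt_min e0 divr_gt0.
rewrite le_min => /and3P[h0 he]; rewrite ler_pdivlMr// => hA i.
rewrite inE => /predU1P[->|ir] Ai; last by apply: IH => //; rewrite h0 he.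
have : - `|B j| <= B j by rewrite lerNl -normrN ler_norm.
nra.
Qed.

(** Differences of points of [A] lie in the direction space [W], which therefore contains every
    ['e_i]. *)
Lemma affine_dim_full (A : set 'rV[R]_n) y e d : e != 0 ->
  A y -> (forall i : 'I_n, A (y + e *: 'e_i)) -> has_affine_dim A d -> d = n.
Proof.
move=> e0 Ay Ae [p [W [<- hull]]].
have sub z : A z -> z - p \in W.
  move=> Az; have : affine_hull A z.
    exists 1%N, (fun=> 1), (fun=> z); split=> //; rewrite big_ord1//.
    by rewrite scale1r.
  by rewrite hull => -[w wW <-]; rewrite addrC addKr.
suff -> : W = fullv by rewrite dimvf dim_matrix/= mul1r.
apply/vspaceP => u; rewrite memvf.
rewrite [u]row_sum_delta; apply: memv_suml => i _; apply: memvZ.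
have : e^-1 *: ((y + e *: 'e_i - p) - (y - p)) \in W.
  by apply: memvZ; apply: memvB; apply: sub.
by rewrite opprB addrA subrK addrC addKr scalerK.
Qed.

(* The active constraints at x are those of gap 0: if v strictly relaxes all
   of them, so do all directions near v, and the cell is full-dimensional. *)
Lemma voronoi_cell_full T S x v d :
  voronoi_cell T S x ->
  (forall s t, s \in S -> t \in (T `\` S)%fset ->
     0 < gap x s t \/ 0 < dot v (s - t)) ->
  has_affine_dim (voronoi_cell T S) d -> d = n.
Proof.
move=> /voronoi_cellP Vx Hv.
(* An index is a constraint with a direction: [None] for the base point, [Some i] for its shift
   along ['e_i]. First [h] is chosen so that every [v + h *: 'e_i] still relaxes what [v] relaxes,
   then [e] so that slack constraints stay slack. *)
pose I := (('rV[R]_n * 'rV[R]_n) * option 'I_n)%type.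
pose r : seq I := [seq (st, o) | st <- [seq (s, t) | s <- enum_fset S,
   t <- enum_fset (T `\` S)%fset], o <- enum {: option 'I_n}].
have rP s t o : s \in S -> t \in (T `\` S)%fset -> (s, t, o) \in r.
  move=> sS tS; apply/allpairsP; exists ((s, t), o); split=> //=.
    by apply/allpairsP; exists (s, t).
  by rewrite mem_enum.
pose dir (o : option 'I_n) : 'rV[R]_n := if o is Some i then 'e_i else 0.
have [h h0 Hh] := small_perturbation r
  (fun i => dot v (i.1.1 - i.1.2)) (fun i => dot (dir i.2) (i.1.1 - i.1.2)).
pose w o := v + h *: dir o.
have [e e0 He] := small_perturbation r
  (fun i => gap x i.1.1 i.1.2) (fun i => 2 * dot (w i.2) (i.1.1 - i.1.2)).
have Vw o : voronoi_cell T S (x + e *: w o).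
  apply/voronoi_cellP => s t sS tS; rewrite gap_line.
  have ir := rP s t o sS tS; have g0 := Vx s t sS tS.
  have [gt0|vt0] := Hv s t sS tS; first exact/ltW/(He _ ir).
  rewrite addr_ge0// mulr_ge0//; first exact: ltW.
  by rewrite mulr_ge0//= dotDl dotZl; apply/ltW/(Hh _ ir).
apply: (@affine_dim_full _ (x + e *: v) (e * h)).
- by rewrite mulf_neq0// gt_eqF.
- by move: (Vw None); rewrite /w/= scaler0 addr0.
- by move=> i; move: (Vw (Some i)); rewrite /w/= scalerDr scalerA addrA.
Qed.

Lemma set1_has_affine_dim0 x : has_affine_dim [set x]%classic 0.
Proof.
exists x, 0%VS; split; first exact: dimv0.
apply/seteqP; split=> [y [k [c [p [px c1 ->]]]]|y [w /=]].
  exists 0; first exact: mem0v.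
  rewrite addr0 (eq_bigr (fun i => c i *: x)) => [|i _]; last by rewrite px.
  by rewrite -scaler_suml c1 scale1r.
rewrite memv0 => /eqP-> <-; rewrite addr0.
by exists 1%N, (fun=> 1), (fun=> x); split=> //; rewrite big_ord1// scale1r.
Qed.

End Dimension.

(** * Plane geometry of two-point cells and cyclic quadrilaterals *)

Section Plane.
Variable R : realType.
Implicit Types (a b c d o x v : 'rV[R]_2) (S T : {fset 'rV[R]_2}).

Lemma dot2E (u v : 'rV[R]_2) : dot u v = u 0 0 * v 0 0 + u 0 1 * v 0 1.
Proof.
rewrite /dot big_ord_recl big_ord1.
by have -> : lift ord0 ord0 = 1 :> 'I_2 by apply/val_inj.
Qed.

Lemma row2P (u v : 'rV[R]_2) : u 0 0 = v 0 0 -> u 0 1 = v 0 1 -> u = v.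
Proof.
move=> e0 e1; apply/rowP; case=> [[|[|//]]] i.
- by move: e0; congr (_ = _); congr fun_of_matrix; apply/val_inj.
- by move: e1; congr (_ = _); congr fun_of_matrix; apply/val_inj.
Qed.

Lemma dist2_gt0 a b : a != b -> 0 < dot (a - b) (a - b).
Proof.
move=> ab; rewrite lt_def dot_ge0 andbT; apply: contra ab.
rewrite dot2E !mxE -!expr2 paddr_eq0 ?sqr_ge0// !sqrf_eq0 !subr_eq0.
by move=> /andP[/eqP e0 /eqP e1]; apply/eqP/row2P.
Qed.

(** A line meets a circle in at most two points; this turns distinctness into nonzero signed
    areas. *)
Lemma equidistant_noncollinear x a b c :
  dot (x - a) (x - a) = dot (x - b) (x - b) ->
  dot (x - a) (x - a) = dot (x - c) (x - c) ->
  a != b -> a != c -> b != c -> signed_area2 a b c != 0.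
Proof.
move=> eb ec /dist2_gt0 ab /dist2_gt0 ac; apply: contra => /eqP.
rewrite /signed_area2; move: eb ec ab ac.
rewrite !dot2E !mxE.
set a0 := a 0 0; set a1 := a 0 1; set b0 := b 0 0; set b1 := b 0 1.
set c0 := c 0 0; set c1 := c 0 1; set x0 := x 0 0; set x1 := x 0 1.
move=> eb ec ab ac area.
(* With [u = b - a] and [w = c - a], equidistance makes the squared length [U] of [u] equal to
   [-2 u.(a - x)], and likewise [W] for [w]. Collinearity then gives [U w = W u]; comparing squared
   lengths yields [U = W], hence [b = c]. *)
pose u0 := b0 - a0; pose u1 := b1 - a1; pose w0 := c0 - a0; pose w1 := c1 - a1.
pose U := u0 ^+ 2 + u1 ^+ 2; pose W := w0 ^+ 2 + w1 ^+ 2.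
have U0 : 0 < U by rewrite /U /u0 /u1; nra.
have W0 : 0 < W by rewrite /W /w0 /w1; nra.
have eU : U = - 2 * (u0 * (a0 - x0) + u1 * (a1 - x1)).
  by rewrite /U /u0 /u1; lra.
have eW : W = - 2 * (w0 * (a0 - x0) + w1 * (a1 - x1)).
  by rewrite /W /w0 /w1; lra.
have {}area : u0 * w1 - u1 * w0 = 0 by [].
have e0 : w0 * U = u0 * W.
  apply/eqP; rewrite -subr_eq0 eU eW; apply/eqP.
  by transitivity (2 * (a1 - x1) * (u0 * w1 - u1 * w0));
    [ring | rewrite area mulr0].
have e1 : w1 * U = u1 * W.
  apply/eqP; rewrite -subr_eq0 eU eW; apply/eqP.
  by transitivity (- 2 * (a0 - x0) * (u0 * w1 - u1 * w0));
    [ring | rewrite area mulr0].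
have UW : U = W.
  have : U * W * (U - W) = 0.
    have -> : U * W * (U - W) =
      (w0 * U) * (w0 * U) + (w1 * U) * (w1 * U) - U * W * W by rewrite /W; ring.
    by rewrite e0 e1 /U; ring.
  by move/eqP; rewrite mulf_eq0 gt_eqF ?mulr_gt0//= subr_eq0 => /eqP.
move: e0 e1; rewrite UW => /(mulIf (lt0r_neq0 W0)) e0 /(mulIf (lt0r_neq0 W0)) e1.
apply/eqP/row2P; rewrite -/b0 -/b1 -/c0 -/c1.
- by move: e0; rewrite /w0 /u0 => /addIr.
- by move: e1; rewrite /w1 /u1 => /addIr.
Qed.

Lemma convex_of_crossing a b c d :
  signed_area2 a c b * signed_area2 a c d < 0 ->
  signed_area2 b d a * signed_area2 b d c < 0 ->
  convex_quadrilateral a b c d.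
Proof.
rewrite /convex_quadrilateral /same_strict_side.
pose p := signed_area2 a b c; pose q := signed_area2 a c d.
pose r := signed_area2 b c d; pose s := signed_area2 a b d.
have -> : signed_area2 a c b = - p by rewrite /p /signed_area2; ring.
have -> : signed_area2 b d a = s by rewrite /s /signed_area2; ring.
have -> : signed_area2 b d c = - r by rewrite /r /signed_area2; ring.
have -> : signed_area2 b c a = p by rewrite /p /signed_area2; ring.
have -> : signed_area2 c d a = q by rewrite /q /signed_area2; ring.
have -> : signed_area2 c d b = r by rewrite /r /signed_area2; ring.
have -> : signed_area2 d a b = s by rewrite /s /signed_area2; ring.
have -> : signed_area2 d a c = q by rewrite /q /signed_area2; ring.
(* Both sides are twice the signed area of the quadrilateral, cut along [ac] and along [bd]. Since
   [p * q] and [s * r] are positive, all four areas share one sign. *)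
have : p + q = s + r by rewrite /p /q /r /s /signed_area2; ring.
rewrite -/p -/q -/r -/s => e; rewrite !mulNr !mulrN !oppr_lt0 => pq sr.
have [p0|p0|p0] := ltgtP p 0; last by move: pq; rewrite p0 mul0r ltxx.
- have q0 : q < 0 by move: pq; rewrite nmulr_rgt0.
  have s0 : s < 0 by nra.
  have r0 : r < 0 by nra.
  by split; nra.
- have q0 : 0 < q by move: pq; rewrite pmulr_rgt0.
  have s0 : 0 < s by nra.
  have r0 : 0 < r by nra.
  by split; nra.
Qed.

Lemma opposite_sides a c b d :
  signed_area2 a c b != 0 -> signed_area2 a c d != 0 ->
  (forall v, ~ [/\ 0 < dot v (a - b), 0 < dot v (a - d),
                   0 < dot v (c - b) & 0 < dot v (c - d)]) ->
  signed_area2 a c b * signed_area2 a c d < 0.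
Proof.
move=> b0 d0 Nv; rewrite ltNge; apply/negP => H.
(* [z] is normal to [ac], and the factor [k] below turns it away from [b], hence also from [d] if
   both lie on the same side; [Nv] excludes such a vector. *)
pose z := \row_(i < 2) (if i == 0 then c 0 1 - a 0 1 else a 0 0 - c 0 0).
have zE (k : R) p : dot (k *: z) (a - p) = k * signed_area2 a c p /\
                    dot (k *: z) (c - p) = k * signed_area2 a c p.
  by rewrite !dot2E /signed_area2 !mxE/=; split; ring.
pose k := signed_area2 a c b.
have := Nv (k *: z); case: (zE k b) (zE k d) => -> -> [-> ->]; apply.
have kd : 0 < k * signed_area2 a c d by rewrite lt_def mulf_neq0.
by have kk : 0 < k * k; [rewrite lt_def mulf_neq0// -expr2 sqr_ge0|].
Qed.

(** In the tight case [s] and [t] are equidistant from [x], and the product is half the squared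
    length of [s - t]; the same holds in [relax_away]. *)
Lemma relax_toward x s t : s != t -> 0 <= gap x s t ->
  0 < gap x s t \/ 0 < dot (s - x) (s - t).
Proof.
move=> /dist2_gt0; rewrite le0r /gap !dot2E !mxE => st.
move=> /orP[/eqP g0|->]; last by left.
by right; lra.
Qed.

Lemma relax_away x s t : s != t -> 0 <= gap x s t ->
  0 < gap x s t \/ 0 < dot (x - t) (s - t).
Proof.
move=> /dist2_gt0; rewrite le0r /gap !dot2E !mxE => st.
move=> /orP[/eqP g0|->]; last by left.
by right; lra.
Qed.

Lemma cyclic_of_tight a b c d x :
  a != b -> a != d -> c != b -> c != d -> a != c -> b != d ->
  0 <= gap x a b -> 0 <= gap x a d -> 0 <= gap x c b -> 0 <= gap x c d ->
  (forall v, ~ [/\ 0 < gap x a b \/ 0 < dot v (a - b),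
                   0 < gap x a d \/ 0 < dot v (a - d),
                   0 < gap x c b \/ 0 < dot v (c - b) &
                   0 < gap x c d \/ 0 < dot v (c - d)]) ->
  cyclic_quadrilateral a b c d.
Proof.
move=> ab ad cb cd ac bd gab gad gcb gcd Nv.
(* If [a] were strictly closer to [x] than [c], both constraints on [a] would be slack, while
   [c - x] relaxes the tight ones on [c]. The next three claims follow the same pattern. *)
have Lac : ~~ (dot (x - a) (x - a) < dot (x - c) (x - c)).
  apply/negP => lt; apply: (Nv (c - x)); split; try exact: relax_toward.
  - by left; move: gcb; rewrite /gap; lra.
  - by left; move: gcd; rewrite /gap; lra.
have Lca : ~~ (dot (x - c) (x - c) < dot (x - a) (x - a)).
  apply/negP => lt; apply: (Nv (a - x)); split; try exact: relax_toward.
  - by left; move: gab; rewrite /gap; lra.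
  - by left; move: gad; rewrite /gap; lra.
have Lbd : ~~ (dot (x - b) (x - b) < dot (x - d) (x - d)).
  apply/negP => lt; apply: (Nv (x - b)); split; try exact: relax_away.
  - by left; move: gab; rewrite /gap; lra.
  - by left; move: gcb; rewrite /gap; lra.
have Ldb : ~~ (dot (x - d) (x - d) < dot (x - b) (x - b)).
  apply/negP => lt; apply: (Nv (x - d)); split; try exact: relax_away.
  - by left; move: gad; rewrite /gap; lra.
  - by left; move: gcd; rewrite /gap; lra.
have eac : dot (x - a) (x - a) = dot (x - c) (x - c).
  by apply: le_anti; rewrite !leNgt Lac Lca.
have ebd : dot (x - b) (x - b) = dot (x - d) (x - d).
  by apply: le_anti; rewrite !leNgt Lbd Ldb.
(* All four gaps now agree; were they positive, no constraint would be tight and even the zero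
   direction would contradict [Nv]. *)
have eab : dot (x - a) (x - a) = dot (x - b) (x - b).
  apply/eqP; rewrite eq_le -subr_ge0 gab leNgt; apply/negP => lt.
  by apply: (Nv 0); split; left; rewrite /gap; lra.
have ead : dot (x - a) (x - a) = dot (x - d) (x - d) by rewrite eab.
have Nv' v : ~ [/\ 0 < dot v (a - b), 0 < dot v (a - d),
                   0 < dot v (c - b) & 0 < dot v (c - d)].
  by case=> *; apply: (Nv v); split; right.
split.
  apply: convex_of_crossing; apply: opposite_sides => //.
  - by apply: (equidistant_noncollinear eac eab).
  - by apply: (equidistant_noncollinear eac ead).
  - by apply: (equidistant_noncollinear ebd (esym eab)); rewrite // eq_sym.
  - apply: (equidistant_noncollinear ebd (etrans (esym eab) eac)) => //.
      by rewrite eq_sym.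
    by rewrite eq_sym.
  (* With [bd] as the chord, all four differences change sign, hence [- v]. *)
  - move=> v [H1 H2 H3 H4]; apply: (Nv' (- v)).
    by move: H1 H2 H3 H4; rewrite !dot2E !mxE => *; split; lra.
have enE p : enorm (p - x) = Num.sqrt (dot (x - p) (x - p)).
  by rewrite enormE -dotNN opprB.
exists x, (Num.sqrt (dot (x - a) (x - a))); split; last first.
  by split; rewrite /circle/= enE -?eac -?ead -?eab.
(* Radius zero would put both [a] and [c] at [x]. *)
rewrite sqrtr_gt0 lt_def dot_ge0 andbT; apply/negP => /eqP e0.
have center p : dot (x - p) (x - p) = 0 -> x = p.
  move=> p0; apply/eqP; apply: contraTT (lexx (0 : R)) => /dist2_gt0.
  by rewrite p0 -ltNge.
by move: ac; rewrite -(center a e0) -(center c _) ?eqxx// -eac.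
Qed.

(* With p = [abc], q = [acd], r = [bcd], s = [abd] (signed areas), one has
   r a + s c = q b + p d and r + s = p + q. *)
Lemma convex_quadrilateral_cone0 a b c d v :
  convex_quadrilateral a b c d ->
  0 <= dot v (a - b) -> 0 <= dot v (a - d) ->
  0 <= dot v (c - b) -> 0 <= dot v (c - d) -> v = 0.
Proof.
rewrite /convex_quadrilateral /same_strict_side.
pose p := signed_area2 a b c; pose q := signed_area2 a c d.
pose r := signed_area2 b c d; pose s := signed_area2 a b d.
have -> : signed_area2 b c a = p by rewrite /p /signed_area2; ring.
have -> : signed_area2 c d a = q by rewrite /q /signed_area2; ring.
have -> : signed_area2 c d b = r by rewrite /r /signed_area2; ring.
have -> : signed_area2 d a b = s by rewrite /s /signed_area2; ring.
have -> : signed_area2 d a c = q by rewrite /q /signed_area2; ring.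
rewrite -/p -/r -/s => -[ps rp qr sq] ab ad cb cd.
(* The weights are products of coefficients from the two expressions for the crossing point, so the
   weighted differences sum to zero; each term being nonnegative, each vanishes. *)
have : (q * r) * dot v (a - b) + (r * p) * dot v (a - d) +
       (s * q) * dot v (c - b) + (p * s) * dot v (c - d) = 0.
  by rewrite /p /q /r /s /signed_area2 !dot2E !mxE; ring.
have := mulr_ge0 (ltW qr) ab; have := mulr_ge0 (ltW rp) ad.
have := mulr_ge0 (ltW sq) cb; have := mulr_ge0 (ltW ps) cd.
move=> h4 h3 h2 h1 h.
have ab0 : dot v (a - b) = 0.
  by apply: (mulfI (lt0r_neq0 qr)); rewrite mulr0; lra.
have ad0 : dot v (a - d) = 0.
  by apply: (mulfI (lt0r_neq0 rp)); rewrite mulr0; lra.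
have s0 : s != 0 by apply: contraTneq ps => ->; rewrite mulr0 ltxx.
(* [s] is the determinant of [a - b] and [a - d], both orthogonal to [v], so Cramer's rule gives
   [v = 0]. *)
apply: row2P; rewrite mxE; apply: (mulfI s0); rewrite mulr0.
- transitivity ((a 0 1 - d 0 1) * dot v (a - b) -
                (a 0 1 - b 0 1) * dot v (a - d)).
    by rewrite /s /signed_area2 !dot2E !mxE; ring.
  by rewrite ab0 ad0 !mulr0 subrr.
- transitivity ((a 0 0 - b 0 0) * dot v (a - d) -
                (a 0 0 - d 0 0) * dot v (a - b)).
    by rewrite /s /signed_area2 !dot2E !mxE; ring.
  by rewrite ab0 ad0 !mulr0 subrr.
Qed.

Lemma convex_quadrilateral_neq a b c d :
  convex_quadrilateral a b c d -> [/\ b != a, b != c, d != a & d != c].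
Proof.
rewrite /convex_quadrilateral /same_strict_side => -[H1 H2 H3 H4].
split; apply/eqP => e; [move: H1|move: H2|move: H4|move: H3];
  by rewrite e /signed_area2 !subrr !(mul0r, subr0, ltxx).
Qed.

(** All gaps vanish at the circumcenter [o], so [gap_line] from [o] to a point [x] of the cell
    yields the four inequalities on [x - o] that force it to be zero. *)
Lemma voronoi_cell_cyclic a b c d : cyclic_quadrilateral a b c d ->
  exists x,
    voronoi_cell [fset a; b; c; d]%fset [fset a; c]%fset = [set x]%classic.
Proof.
move=> [cvx [o [r [_ [Ca Cb Cc Cd]]]]].
have [ba bc da dc] := convex_quadrilateral_neq cvx.
have TSE t : (t \in [fset a; b; c; d] `\` [fset a; c])%fset = (t == b) || (t == d).
  rewrite !inE; have [->|ta] := eqVneq t a; last have [->|tc] := eqVneq t c.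
  - by rewrite !(eq_sym a) (negbTE ba) (negbTE da).
  - by rewrite !(eq_sym c) (negbTE bc) (negbTE dc) orbT.
  - by rewrite /= orbF.
have dE p : circle o r p -> dot (o - p) (o - p) = r ^+ 2.
  rewrite /circle/= enormE -dotNN opprB => <-.
  by rewrite sqr_sqrtr// dot_ge0.
have g0 s t : circle o r s -> circle o r t -> gap o s t = 0.
  by move=> /dE es /dE et; rewrite /gap es et subrr.
exists o; apply/seteqP; split=> [x /voronoi_cellP Vx|x ->]; last first.
  apply/voronoi_cellP => s t; rewrite TSE !inE.
  by move=> /orP[]/eqP-> /orP[]/eqP->; rewrite g0.
have Vd s t : s \in [fset a; c]%fset -> (t == b) || (t == d) ->
    circle o r s -> circle o r t -> 0 <= dot (x - o) (s - t).
  move=> sS tS /g0 /[apply] g; have := Vx s t sS; rewrite TSE => /(_ tS).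
  have := gap_line o (x - o) 1 s t.
  by rewrite scale1r subrKC g add0r mul1r => ->; rewrite pmulr_rge0.
apply/eqP; rewrite -subr_eq0; apply/eqP.
by apply: (convex_quadrilateral_cone0 cvx); apply: Vd; rewrite ?inE ?eqxx ?orbT.
Qed.

Lemma cardfs2_ex (K : choiceType) (A : {fset K}) :
  #|` A|%fset = 2 -> exists a b : K, a != b /\ A = [fset a; b]%fset.
Proof.
move=> A2; have /fset0Pn[a aA] : A != fset0 by rewrite -cardfs_eq0 A2.
have /eqP/cardfs1P[b Ab] : #|` (A `\ a)%fset|%fset = 1%N.
  by move: A2; rewrite (cardfsD1 a) aA => -[].
exists a, b; split; last by rewrite -[LHS](fsetD1K aA) Ab.
have : b \in (A `\ a)%fset by rewrite Ab inE.
by rewrite !inE eq_sym => /andP[].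
Qed.

End Plane.

Theorem proposition3p1 (R : realType) (S T : {fset 'rV[R]_2})
    (hST : (S `<=` T)%fset) (hS : #|` S|%fset = 2) (hT : #|` T|%fset = 4) :
  [<-> (voronoi_cell T S !=set0)%classic /\
       (exists2 d : nat, has_affine_dim (voronoi_cell T S) d & (d <= 1)%N);
       exists a b c d : 'rV[R]_2,
         [/\ cyclic_quadrilateral a b c d,
             T = [fset a; b; c; d]%fset & S = [fset a; c]%fset];
       exists x : 'rV[R]_2, voronoi_cell T S = [set x]%classic].
Proof.
have [a [c [ac SE]]] := cardfs2_ex hS.
have /cardfs2_ex[b [d [bd DE]]] : #|` (T `\` S)%fset|%fset = 2.
  by rewrite cardfsDS// hT hS.
have TE : T = [fset a; b; c; d]%fset.
  apply/fsetP => t; move/fsubsetP/(_ t): hST; move/fsetP/(_ t): DE.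
  by rewrite SE !inE; case: (t == a) (t == c) => [|] [|] /=;
    rewrite ?orbT ?orbF// => _ /(_ isT) ->.
have NS t : t \in (T `\` S)%fset -> a != t /\ c != t.
  by rewrite SE !inE negb_or !(eq_sym t) => /andP[/andP[]].
have aS : a \in S by rewrite SE !inE eqxx.
have cS : c \in S by rewrite SE !inE eqxx orbT.
have bT : b \in (T `\` S)%fset by rewrite DE !inE eqxx.
have dT : d \in (T `\` S)%fset by rewrite DE !inE eqxx orbT.
have [[ab cb] [ad cd]] := (NS b bT, NS d dT).
tfae.
- move=> [[x Vx] [k Vk k1]]; exists a, b, c, d; split=> //.
  have /voronoi_cellP gx := Vx.
  apply: (@cyclic_of_tight _ _ _ _ _ x) => //; try exact: gx.
  (* A [v] relaxing every tight constraint would make the cell two-dimensional, against [k <= 1]. *)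
  move=> v [H1 H2 H3 H4].
  suff k2 : k = 2 by rewrite k2 in k1.
  apply: (voronoi_cell_full Vx _ Vk) => s t.
  by rewrite DE SE !inE => /orP[]/eqP-> /orP[]/eqP->; eassumption.
- move=> [a' [b' [c' [d' [cyc -> ->]]]]]; exact: voronoi_cell_cyclic.
- move=> [x ->]; split; first by exists x.
  by exists 0%N => //; apply: set1_has_affine_dim0.
Qed.
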